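(* For every $n\ge 5$, the wheel graph $W_n$ with $n$ vertices satisfies \[ \operatorname{nim}(\mathrm{DNT}(W_n))=\begin{cases} 0, & n \in \{18,38\} \text{ or } n \bmod 34 \in \{8,12,24,28,32\}\\ 1, & \text{otherwise}. \end{cases} \]
   Context: $W_n$ is the graph on $n$ vertices $v_1,\dots,v_{n-1},c$, where the center $c$ is adjacent to every $v_i$, and $v_i$ is adjacent to $v_{i+1}$ (indices modulo $n-1$). For a graph $G$ with vertex set $V$, a set $K\subseteq V$ is convex if it contains every vertex lying on any shortest path between two elements of $K$. The convex hull $[P]$ of $P\subseteq V$ is the smallest convex set containing $P$. The game $\mathrm{DNT}(G)$: positions are the sets $P\subseteq V$ with $[V\setminus P]=V$; the starting position is $\emptyset$; the options of $P$ are the sets $P\cup\{v\}$ with $v\in V\setminus P$ and $[V\setminus(P\cup\{v\})]=V$. The nim-value of a position is defined recursively by $\operatorname{nim}(p)=\operatorname{mex}\{\operatorname{nim}(q): q\text{ an option of }p\}$, where $\operatorname{mex}(A)$ is the smallest nonnegative integer not in $A$; the nim-value of a game is that of its starting position. *)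

(* Defs.v *)
From HB Require Import structures.
From mathcomp Require Import all_boot.

Set Implicit Arguments.
Unset Strict Implicit.
Unset Printing Implicit Defensive.

Section Convexity.

Variables (T : finType) (e : rel T).

(* Following [path], a walk from [x] to [y] is the sequence [p] of the vertices
   visited after [x]; its length is [size p]. *)
Definition walk (x y : T) (p : seq T) : bool := path e x p && (last x p == y).

Definition shortest_path (x y : T) (p : seq T) : bool :=
  walk x y p && [forall k : 'I_(size p), ~~ [exists q : k.-tuple T, walk x y q]].

(* The bound on the length [k] only serves to make convexity boolean; [convexP]
   removes it. *)
Definition convex (K : {set T}) : bool :=
  [forall x in K, forall y in K, forall k : 'I_#|T|, forall p : k.-tuple T,
     shortest_path x y p ==> (p \subset K)].

Definition hull (P : {set T}) : {set T} :=
  \bigcap_(K : {set T} | convex K && (P \subset K)) K.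

Lemma shortest_pathP x y p :
  reflect (walk x y p /\ forall q, walk x y q -> size p <= size q)
          (shortest_path x y p).
Proof.
apply: (iffP andP) => -[wp min_p]; split=> //.
  move=> q wq; rewrite leqNgt; apply/negP => lt_qp.
  move/forallP/(_ (Ordinal lt_qp))/negP: min_p; apply.
  by apply/existsP; exists (in_tuple q).
apply/forallP => k; apply/existsP => -[q wq].
by have := min_p q wq; rewrite size_tuple leqNgt ltn_ord.
Qed.

Lemma shortest_path_size x y p : shortest_path x y p -> size p < #|T|.
Proof.
case/shortest_pathP=> /andP[ep /eqP def_y] min_p.
move: def_y; case: (shortenP ep) => p' ep' Up' _ def_y.
have /min_p le_pp' : walk x y p' by rewrite /walk ep' def_y eqxx.
apply: leq_ltn_trans le_pp' _.
by have := max_card (mem (x :: p')); rewrite (card_uniqP Up').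
Qed.

Lemma convexP (K : {set T}) :
  reflect (forall x y p, x \in K -> y \in K -> shortest_path x y p ->
             {subset p <= K})
          (convex K).
Proof.
apply: (iffP forall_inP) => [cK x y p Kx Ky sp | cK x Kx].
  move/(_ x Kx)/forall_inP/(_ y Ky)/forallP: cK.
  move/(_ (Ordinal (shortest_path_size sp)))/forallP/(_ (in_tuple p)).
  by move/implyP/(_ sp)/subsetP.
apply/forall_inP => y Ky; apply/forallP => k; apply/forallP => p.
by apply/implyP => sp; apply/subsetP; apply: cK sp.
Qed.

Lemma sub_hull (P : {set T}) : P \subset hull P.
Proof. by apply/bigcapsP => K /andP[]. Qed.

Lemma hull_min (P K : {set T}) : convex K -> P \subset K -> hull P \subset K.
Proof. by move=> cK sPK; apply: bigcap_inf; rewrite cK. Qed.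

Lemma convex_hull (P : {set T}) : convex (hull P).
Proof.
apply/convexP => x y p Hx Hy sp z pz; apply/bigcapP => K PK.
have /andP[/convexP cK _] := PK.
by apply: cK sp z pz; [move/bigcapP: Hx | move/bigcapP: Hy]; apply.
Qed.

End Convexity.

Lemma mex_exists (s : seq nat) : exists k, k \notin s.
Proof.
exists (sumn s).+1; apply/negP => /perm_to_rem/perm_sumn /= def_s.
by move: (ltnn (sumn s)); rewrite {2}def_s addSn ltnS leq_addr.
Qed.

Definition mex (s : seq nat) : nat := ex_minn (mex_exists s).

Section DoNotGenerate.

Variables (T : finType) (e : rel T).

Definition DNT_position (P : {set T}) : bool := hull e (~: P) == [set: T].

Definition DNT_options (P : {set T}) : {set {set T}} :=
  [set v |: P | v in ~: P & DNT_position (v |: P)].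

(* Every move removes one element from [~: P], so [#|~: P|] is enough fuel;
   [DNT_nimE] is the unfuelled recursion. *)
Fixpoint DNT_nim_rec (k : nat) (P : {set T}) : nat :=
  if k is k'.+1 then mex [seq DNT_nim_rec k' Q | Q in DNT_options P] else 0.

Definition DNT_nim (P : {set T}) : nat := DNT_nim_rec #|~: P| P.

Definition nim_DNT : nat := DNT_nim set0.

Lemma card_DNT_options P Q : Q \in DNT_options P -> #|~: P| = #|~: Q|.+1.
Proof.
case/imsetP => v /[!inE] /andP[vP _] ->.
by rewrite (cardsD1 v (~: P)) inE vP setCU setIC setDE.
Qed.

Lemma DNT_nimE P : DNT_nim P = mex [seq DNT_nim Q | Q in DNT_options P].
Proof.
rewrite {1}/DNT_nim; case def_k: #|~: P| => [|k] /=.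
  suff /eq_enum def0 : DNT_options P =i pred0.
    rewrite /image_mem def0 enum0 /mex.
    by case: ex_minnP => m _ /(_ 0)/(_ isT); case: m.
  by move=> Q; apply/negP => /card_DNT_options; rewrite def_k.
congr mex; apply/eq_in_map => Q; rewrite mem_enum => /card_DNT_options.
by rewrite def_k /DNT_nim => -[->].
Qed.

End DoNotGenerate.

(* In [option 'I_n.-1], [None] is the center [c] and [Some i] is the rim vertex
   of index [i]; [ordS] is the successor modulo [n.-1]. *)
Definition wheel (n : nat) : rel (option 'I_n.-1) := fun x y =>
  match x, y with
  | None, None => false
  | Some i, Some j => (j == ordS i) || (i == ordS j)
  | _, _ => true
  end.

Lemma wheel_sym n : symmetric (@wheel n).
Proof. by move=> [i|] [j|] //=; rewrite orbC. Qed.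

Lemma wheel_irr n : 2 < n -> irreflexive (@wheel n).
Proof.
move=> n_gt2 [i|] //=; rewrite orbb; apply/negP => /eqP/(congr1 val) /=.
have := ltn_ord i; rewrite leq_eqVlt => /predU1P[def_n | lt_i].
  by rewrite def_n modnn => i0; move: n_gt2 def_n; rewrite i0; case: n {i i0} => [|[|[]]].
by rewrite modn_small // => /n_Sn.
Qed.

(* Main.v *)
(* A proper convex set of the wheel that contains two nonadjacent rim vertices
   contains the center and has no gap of length one on the rim.  Hence the
   complement of P generates exactly when no two rim vertices of P are adjacent,
   and DNT is the sum of a one-move game (taking the center) and of Node Kayles
   on the rim cycle.  The first rim move leaves a path with n - 4 vertices, so the
   nim-value is 1 if that path has nonzero value and 0 otherwise.  Node Kayles on
   paths is Dawson's chess, whose nim-values have period 34 from 52 on: splitting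
   a path of at least 176 vertices leaves a component of at least 86 vertices, and
   shortening it by 34 changes no value, so finitely many values decide. *)
Require Import Defs.
From mathcomp Require Import all_boot zify.
From Stdlib Require PeanoNat.

Set Implicit Arguments.
Unset Strict Implicit.
Unset Printing Implicit Defensive.

(** * Mex and nim-sums *)

Lemma mexP (s : seq nat) v :
  reflect (v \notin s /\ forall u, u < v -> u \in s) (mex s == v).
Proof.
rewrite /mex; case: ex_minnP => m ms min_m.
apply: (iffP eqP) => [<- | [vs sv]].
  split=> // u; rewrite ltnNge; apply: contraR => us; exact: min_m.
apply/eqP; rewrite eqn_leq min_m //= leqNgt.
by apply/negP => /sv; apply/negP.
Qed.

Lemma eq_mex (s t : seq nat) : s =i t -> mex s = mex t.
Proof.
move=> est; apply/eqP/mexP.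
have /mexP[tm mt] := eqxx (mex t).
by split=> [|u /mt]; rewrite est.
Qed.

Lemma div2_lxor a b :
  Nat.div2 (Nat.lxor a b) = Nat.lxor (Nat.div2 a) (Nat.div2 b).
Proof. exact: (PeanoNat.Nat.shiftr_lxor a b 1). Qed.

Lemma odd_lxor a b :
  Nat.odd (Nat.lxor a b) = xorb (Nat.odd a) (Nat.odd b).
Proof. by rewrite -!PeanoNat.Nat.bit0_odd PeanoNat.Nat.lxor_spec. Qed.

(* Halving all three arguments; if the halves already satisfy the equation, the
   parities do not, and some odd argument can be decreased by one. *)
Lemma lxor_neq_lt x y z : x != Nat.lxor y z ->
  [|| Nat.lxor y z < x, Nat.lxor x z < y | Nat.lxor x y < z].
Proof.
have [n] := ubnP (maxn x (maxn y z)).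
elim: n x y z => // n IHn x y z lt_n ne_x.
have Dx := PeanoNat.Nat.div2_odd x.
have Dy := PeanoNat.Nat.div2_odd y.
have Dz := PeanoNat.Nat.div2_odd z.
have Dyz := PeanoNat.Nat.div2_odd (Nat.lxor y z).
have Dxz := PeanoNat.Nat.div2_odd (Nat.lxor x z).
have Dxy := PeanoNat.Nat.div2_odd (Nat.lxor x y).
rewrite !div2_lxor !odd_lxor in Dyz Dxz Dxy.
have [eq_x | ne2] := eqVneq (Nat.div2 x) (Nat.lxor (Nat.div2 y) (Nat.div2 z)).
  have eq_y : Nat.lxor (Nat.div2 x) (Nat.div2 z) = Nat.div2 y.
    by rewrite eq_x PeanoNat.Nat.lxor_assoc PeanoNat.Nat.lxor_nilpotent
               PeanoNat.Nat.lxor_0_r.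
  have eq_z : Nat.lxor (Nat.div2 x) (Nat.div2 y) = Nat.div2 z.
    by rewrite eq_x PeanoNat.Nat.lxor_comm -PeanoNat.Nat.lxor_assoc
               PeanoNat.Nat.lxor_nilpotent PeanoNat.Nat.lxor_0_l.
  rewrite -eq_x in Dyz; rewrite eq_y in Dxz; rewrite eq_z in Dxy.
  move: ne_x Dx Dy Dz Dyz Dxz Dxy.
  by case: (Nat.odd x) (Nat.odd y) (Nat.odd z) => [] [] [] /=; lia.
have lt_n2 : maxn (Nat.div2 x) (maxn (Nat.div2 y) (Nat.div2 z)) < n.
  have : ~ (x = 0 /\ y = 0 /\ z = 0).
    by case=> x0 [y0 z0]; rewrite x0 y0 z0 in ne_x.
  by move: lt_n Dx Dy Dz; lia.
move: {IHn}(IHn _ _ _ lt_n2 ne2) Dx Dy Dz Dyz Dxz Dxy.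
case: (Nat.odd x) (Nat.odd y) (Nat.odd z) => [] [] [] /=; lia.
Qed.

Lemma lxor_inj a b c : Nat.lxor a c = Nat.lxor b c -> a = b.
Proof.
move/(congr1 (Nat.lxor^~ c)).
by rewrite !PeanoNat.Nat.lxor_assoc PeanoNat.Nat.lxor_nilpotent
           !PeanoNat.Nat.lxor_0_r.
Qed.

(* The induction step of the Sprague-Grundy theorem. *)
Lemma mex_lxor (s t r : seq nat) :
    (forall u, reflect ((exists2 a, a \in s & u = Nat.lxor a (mex t)) \/
                        (exists2 b, b \in t & u = Nat.lxor (mex s) b))
                       (u \in r)) ->
  mex r = Nat.lxor (mex s) (mex t).
Proof.
move=> rP; have /mexP[sm ms] := eqxx (mex s).
have /mexP[tm mt] := eqxx (mex t).
apply/eqP/mexP; split=> [|u lt_u].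
  apply/negP => /rP[[a sa /lxor_inj eq_a] | [b tb]].
    by rewrite eq_a sa in sm.
  rewrite ![Nat.lxor (mex s) _]PeanoNat.Nat.lxor_comm => /lxor_inj eq_b.
  by rewrite eq_b tb in tm.
have /lxor_neq_lt : u != Nat.lxor (mex s) (mex t) by rewrite neq_ltn lt_u.
(* Since [u] is below the nim-sum, [lxor_neq_lt] lowers one of the two components, and the
   corresponding move has value [u]. *)
rewrite ltnNge (ltnW lt_u) /= => /orP[lt_s | lt_t]; apply/rP.
  left; exists (Nat.lxor u (mex t)); first exact: ms.
  by rewrite PeanoNat.Nat.lxor_assoc PeanoNat.Nat.lxor_nilpotent
             PeanoNat.Nat.lxor_0_r.
right; exists (Nat.lxor u (mex s)); first exact: mt.
by rewrite PeanoNat.Nat.lxor_comm PeanoNat.Nat.lxor_assoc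
           PeanoNat.Nat.lxor_nilpotent PeanoNat.Nat.lxor_0_r.
Qed.

(** * Nim-values of Dawson's chess *)

(** Values of the octal game 0.137 for lengths 0 to 85, that is 52 + 34 entries;
    [mex_dawson_options] proves that they satisfy the recursion. *)
Definition dawson_table : seq nat :=
  [:: 0; 1; 1; 2; 0; 3; 1; 1; 0; 3; 3; 2; 2; 4; 0; 5; 2; 2; 3; 3; 0; 1; 1; 3;
      0; 2; 1; 1; 0; 4; 5; 2; 7; 4; 0; 1; 1; 2; 0; 3; 1; 1; 0; 3; 3; 2; 2; 4;
      4; 5; 5; 2; 3; 3; 0; 1; 1; 3; 0; 2; 1; 1; 0; 4; 5; 3; 7; 4; 8; 1; 1; 2;
      0; 3; 1; 1; 0; 3; 3; 2; 2; 4; 4; 5; 5; 9].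

(* Preperiod of length 52, then period 34. *)
Definition dawson (k : nat) : nat :=
  nth 0 dawson_table (if k < 52 then k else 52 + (k - 52) %% 34).

(* In a path of [k] vertices, choosing vertex [i] leaves paths with [i - 1] and
   [k - i - 2] vertices; truncated subtraction handles the two ends. *)
Definition dawson_options (k : nat) : seq nat :=
  [seq Nat.lxor (dawson i.-1) (dawson (k - i.+2)) | i <- iota 0 k].

Lemma dawson_periodic k : 52 <= k -> dawson (k + 34) = dawson k.
Proof.
move=> ge_k; rewrite /dawson.
have [-> ->] : (k + 34 < 52) = false /\ (k < 52) = false by lia.
have -> : k + 34 - 52 = k - 52 + 34 by lia.
by rewrite modnDr.
Qed.

Lemma mem_dawson_options k u :
  reflect (exists2 i, i < k & u = Nat.lxor (dawson i.-1) (dawson (k - i.+2)))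
          (u \in dawson_options k).
Proof.
by apply: (iffP mapP) => -[i ltik ->]; exists i; rewrite ?mem_iota // in ltik *.
Qed.

(** One of the two remaining paths is so long that changing its length by 34 stays in the periodic
    range and preserves the nim-sum. *)
Lemma dawson_options_periodic k : 142 <= k ->
  dawson_options (k + 34) =i dawson_options k.
Proof.
move=> ge_k u; apply/mem_dawson_options/mem_dawson_options => -[i lti ->].
  (* For [i >= 87] the left path, shortened, keeps [i - 35 >= 52] vertices; otherwise the right one,
     shortened, keeps [k - i - 2 >= 54]. *)
  have [lt_i | ge_i] := ltnP i 87.
    exists i; first lia.
    have -> : k + 34 - i.+2 = k - i.+2 + 34 by lia.
    by rewrite dawson_periodic //; lia.
  exists (i - 34); first lia.
  have -> : i.-1 = (i - 34).-1 + 34 by lia.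
  rewrite dawson_periodic; last lia.
  by congr (Nat.lxor _ (dawson _)); lia.
(* For [i >= 53] the left path already has [i - 1 >= 52] vertices; otherwise the right one has
   [k - i - 2 >= 88]. *)
have [lt_i | ge_i] := ltnP i 53.
  exists i; first lia.
  have -> : k + 34 - i.+2 = k - i.+2 + 34 by lia.
  by rewrite dawson_periodic //; lia.
exists (i + 34); first lia.
have -> : (i + 34).-1 = i.-1 + 34 by lia.
rewrite dawson_periodic; last lia.
by congr (Nat.lxor _ (dawson _)); lia.
Qed.

(** [mex] rests on the opaque [mex_exists], so [ok] spells out the criterion [mexP] as a test that
    can be computed. *)
Lemma mex_dawson_options_small k :
  k < 176 -> mex (dawson_options k) = dawson k.
Proof.
pose ok j := (dawson j \notin dawson_options j) &&
  all (fun u => u \in dawson_options j) (iota 0 (dawson j)).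
have all_ok : all ok (iota 0 176) by vm_compute.
move=> lt_k; have : ok k by apply: (allP all_ok); rewrite mem_iota.
rewrite {all_ok}/ok => /andP[dN /allP sd].
apply/eqP/mexP; split=> [|u lt_u]; first exact: dN.
by apply: (sd u); rewrite mem_iota.
Qed.

(** Induction by steps of 34: from 176 = 142 + 34 on, the lengths [k] and [k - 34] have the same
    option values. *)
Lemma mex_dawson_options k : mex (dawson_options k) = dawson k.
Proof.
elim/ltn_ind: k => k IHk.
have [|ge_k] := ltnP k 176; first exact: mex_dawson_options_small.
have -> : k = (k - 34) + 34 by lia.
rewrite (eq_mex (dawson_options_periodic _)); last lia.
by rewrite dawson_periodic ?IHk //; lia.
Qed.

(** The first 86 values contain a full period. The zeros at 14 and 34 belong to the preperiod and do
    not recur; nor does the zero at 0, which [0 < k] excludes. *)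
Lemma dawson_eq0 k : 0 < k ->
  (dawson k == 0) =
    [|| k == 14, k == 34 | k %% 34 \in [:: 4; 8; 20; 24; 28]].
Proof.
pose ok j := (0 < j) ==> ((dawson j == 0) ==
  [|| j == 14, j == 34 | j %% 34 \in [:: 4; 8; 20; 24; 28]]).
have all_ok : all ok (iota 0 86) by vm_compute.
have small j : j < 86 -> ok j by move=> ?; apply: (allP all_ok); rewrite mem_iota.
elim/ltn_ind: k => k IHk k_gt0.
have [/small/implyP/(_ k_gt0)/eqP // | ge_k] := ltnP k 86.
have Dk : k = (k - 34) + 34 by lia.
have -> : dawson k = dawson (k - 34) by rewrite {1}Dk dawson_periodic; lia.
have -> : k %% 34 = (k - 34) %% 34 by rewrite {1}Dk modnDr.
by rewrite IHk; lia.
Qed.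


(** * Node Kayles on a finite graph *)

Section NodeKayles.

Variables (T : finType) (r : rel T).
Hypothesis r_sym : symmetric r.

Definition closed_nbhd (v : T) : {set T} := [set w | (w == v) || r v w].

(** [k] is fuel: each move removes at least the chosen vertex, so [#|A|] is enough. *)
Fixpoint kayles_rec (k : nat) (A : {set T}) : nat :=
  if k is k'.+1 then mex [seq kayles_rec k' (A :\: closed_nbhd v) | v in A]
  else 0.

Definition kayles (A : {set T}) : nat := kayles_rec #|A| A.

Lemma card_setD_closed_nbhd (A : {set T}) v :
  v \in A -> #|A :\: closed_nbhd v| < #|A|.
Proof.
move=> Av; apply/proper_card/properP; split; first exact: subsetDl.
by exists v => //; rewrite !inE eqxx.
Qed.

Lemma kayles_rec_set0 k : kayles_rec k set0 = 0.
Proof.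
case: k => [|k] //=; apply/eqP/mexP; split=> //.
by apply/imageP => -[v]; rewrite inE.
Qed.

Lemma kayles_rec_stable k l (A : {set T}) :
  #|A| <= k -> #|A| <= l -> kayles_rec k A = kayles_rec l A.
Proof.
elim: k l A => [|k IHk] [|l] A le_k le_l;
  try by have -> : A = set0 by [apply/eqP; rewrite -cards_eq0; lia];
         rewrite !kayles_rec_set0.
rewrite /=; congr mex; apply/eq_in_map => v.
rewrite mem_enum => /card_setD_closed_nbhd lt_v.
by apply: IHk; lia.
Qed.

Lemma kaylesE A : kayles A = mex [seq kayles (A :\: closed_nbhd v) | v in A].
Proof.
rewrite /kayles (@kayles_rec_stable _ #|A|.+1) //=.
congr mex; apply/eq_in_map => v; rewrite mem_enum => /card_setD_closed_nbhd.
by move/ltnW/kayles_rec_stable; apply.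
Qed.

(** With no edge between the parts, a move in one leaves the other intact. By induction on the
    number of vertices the options are nim-sums, and [mex_lxor] applies. *)
Lemma kaylesU (A B : {set T}) :
    [disjoint A & B] -> (forall x y, x \in A -> y \in B -> ~~ r x y) ->
  kayles (A :|: B) = Nat.lxor (kayles A) (kayles B).
Proof.
have [n] := ubnP #|A :|: B|.
elim: n A B => // n IHn A B lt_n dAB rAB.
have disj x : x \in A -> x \in B -> False.
  by move=> Ax; apply/negP; rewrite (disjointFr dAB Ax).
have optA a : a \in A -> kayles ((A :|: B) :\: closed_nbhd a)
    = Nat.lxor (kayles (A :\: closed_nbhd a)) (kayles B).
  move=> Aa; have -> : (A :|: B) :\: closed_nbhd a = (A :\: closed_nbhd a) :|: B.
    apply/setP=> x; rewrite !inE; case Bx: (x \in B); rewrite ?orbF // !orbT andbT.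
    rewrite (negPf (rAB _ _ Aa Bx)) orbF.
    by apply/negP => /eqP eq_x; apply: (disj a); rewrite // -eq_x.
  apply: IHn => [||x y /setDP[Ax _]]; last exact: rAB.
    rewrite -ltnS; apply: leq_trans lt_n; rewrite ltnS.
    apply: proper_card; apply/properP; split.
      by apply: setSU; apply: subsetDl.
    exists a; rewrite !inE ?Aa // eqxx /=; apply/negP; exact: disj.
  by apply: disjointWl dAB; apply: subsetDl.
have optB b : b \in B -> kayles ((A :|: B) :\: closed_nbhd b)
    = Nat.lxor (kayles A) (kayles (B :\: closed_nbhd b)).
  move=> Bb; have -> : (A :|: B) :\: closed_nbhd b = A :|: (B :\: closed_nbhd b).
    apply/setP=> x; rewrite !inE; case Ax: (x \in A); rewrite //= andbT.
    rewrite r_sym (negPf (rAB _ _ Ax Bb)) orbF.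
    by apply/negP => /eqP eq_x; apply: (disj b); rewrite // -eq_x.
  apply: IHn => [||x y Ax /setDP[By _]]; last exact: rAB.
    rewrite -ltnS; apply: leq_trans lt_n; rewrite ltnS.
    apply: proper_card; apply/properP; split.
      by apply: setUS; apply: subsetDl.
    exists b; rewrite !inE ?Bb ?orbT // eqxx /= orbF; apply/negP.
    by move/disj; apply.
  by apply: disjointWr dAB; apply: subsetDl.
rewrite kaylesE [kayles A]kaylesE [kayles B]kaylesE.
apply: mex_lxor => u; rewrite -!kaylesE; apply: (iffP imageP).
  case=> x /setUP[Ax | Bx] ->.
    left; exists (kayles (A :\: closed_nbhd x)); last by rewrite optA.
    by apply/imageP; exists x.
  right; exists (kayles (B :\: closed_nbhd x)); last by rewrite optB.
  by apply/imageP; exists x.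
case=> -[_ /imageP[x Dx ->] ->]; exists x; rewrite ?inE ?Dx ?orbT //.
  by rewrite optA.
by rewrite optB.
Qed.

(** [f] enumerates an induced path, with conditions only below [k], so that both segments left by a
    move are again of this form. *)
Lemma kayles_path (f : nat -> T) k :
    {in gtn k &, injective f} ->
    {in gtn k &, forall i j, r (f i) (f j) = (j == i.+1) || (i == j.+1)} ->
  kayles [set f i | i : 'I_k] = dawson k.
Proof.
elim/ltn_ind: k f => k IHk f f_inj rf.
have memf (g : nat -> T) l x :
    reflect (exists2 i, i < l & x = g i) (x \in [set g i | i : 'I_l]).
  apply: (iffP imsetP) => [[i _ ->] | [i lt_i ->]]; first by exists i.
  by exists (Ordinal lt_i).
have opt i : i < k -> kayles ([set f i | i : 'I_k] :\: closed_nbhd (f i))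
    = Nat.lxor (dawson i.-1) (dawson (k - i.+2)).
  (* The move at [f i] also removes its neighbours: [f] enumerates the left segment and [g] the
     right one, either possibly empty. *)
  move=> lt_i; pose g j := f (i.+2 + j).
  rewrite -(IHk _ _ f); try lia; first last.
  - by move=> x y lt_x lt_y; apply: rf; rewrite !inE in lt_x lt_y *; lia.
  - by move=> x y lt_x lt_y; apply: f_inj; rewrite !inE in lt_x lt_y *; lia.
  rewrite -(IHk _ _ g); try lia; first last.
  - move=> x y; rewrite !inE => lt_x lt_y; rewrite rf ?inE; lia.
  - move=> x y; rewrite !inE => lt_x lt_y /f_inj; rewrite !inE => H.
    by have := H ltac:(lia) ltac:(lia); lia.
  rewrite -kaylesU.
  - congr kayles; apply/setP => x; rewrite in_setD in_setU.
    apply/andP/orP => [[] | [] /memf[j lt_j ->]].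
    + rewrite inE => Nx /memf[j lt_j Dx]; move: Nx; rewrite Dx rf ?inE // => Nj.
      have ne_ij : j != i by apply: contraNneq Nj => ->; rewrite eqxx.
      have [lt_ji | le_ij] := ltnP j i.-1.
        by left; apply/memf; exists j.
      right; apply/memf; exists (j - i.+2); first lia.
      by rewrite /g; congr f; lia.
    + split; last by apply/memf; exists j => //; lia.
      rewrite inE rf ?inE; try lia.
      rewrite negb_or; apply/andP; split; last lia.
      by apply/eqP => /f_inj; rewrite !inE => H;
         have := H ltac:(lia) ltac:(lia); lia.
    + split; last by apply/memf; exists (i.+2 + j) => //; lia.
      rewrite inE rf ?inE; try lia.
      rewrite negb_or; apply/andP; split; last lia.
      by apply/eqP => /f_inj; rewrite !inE => H;
         have := H ltac:(lia) ltac:(lia); lia.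
  - apply/pred0P => x /=; apply/negP => /andP[/memf[a lt_a ->] /memf[b lt_b]].
    by move/f_inj; rewrite !inE => H; have := H ltac:(lia) ltac:(lia); lia.
  - move=> _ _ /memf[a lt_a ->] /memf[b lt_b ->].
    by rewrite rf ?inE; lia.
rewrite kaylesE -mex_dawson_options; apply: eq_mex => u.
apply/imageP/mem_dawson_options => [[_ /memf[i lt_i ->] ->] | [i lt_i ->]].
  by exists i; rewrite ?opt.
by exists (f i); rewrite ?opt //; apply/memf; exists i.
Qed.

(** * From avoidance games to Node Kayles *)

Definition independent (P : {set T}) : bool :=
  [forall x in P, forall y in P, ~~ r x y].

(* [r] is the relation forbidding two vertices to be chosen together. *)
Definition available (P : {set T}) : {set T} :=
  [set v in ~: P | [forall w in P, ~~ r v w]].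

Lemma independentP (P : {set T}) :
  reflect {in P &, forall x y, ~~ r x y} (independent P).
Proof.
apply: (iffP forall_inP) => [H x y Px | H x Px].
  by move/(_ x Px)/forall_inP: H; apply.
by apply/forall_inP => y; apply: H.
Qed.

Lemma availableP (P : {set T}) v :
  reflect (v \notin P /\ {in P, forall w, ~~ r v w}) (v \in available P).
Proof.
rewrite !inE; apply: (iffP andP) => -[vP].
  by move/forall_inP.
by move/forall_inP.
Qed.

Lemma available0 : available set0 = setT.
Proof.
by apply/setP => v; rewrite in_setT; apply/availableP; split=> [|w]; rewrite inE.
Qed.

Lemma independentU1 (P : {set T}) v : irreflexive r -> independent P -> v \notin P ->
  independent (v |: P) = (v \in available P).
Proof.
move=> r_irr /independentP iP vP; apply/independentP/availableP => [ivP | [_ rvP]].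
  by split=> // w Pw; apply: ivP; rewrite !inE ?eqxx ?Pw ?orbT.
move=> x y /setU1P[-> | Px] /setU1P[-> | Py]; rewrite ?r_irr //.
- exact: rvP.
- by rewrite r_sym; apply: rvP.
- exact: iP.
Qed.

(** Under the independence rule the available set thus evolves as a Node Kayles position. *)
Lemma availableU1 P v : available (v |: P) = available P :\: closed_nbhd v.
Proof.
apply/setP => x; rewrite in_setD [x \in closed_nbhd v]inE negb_or.
apply/availableP/andP => [[xvP rx] | [/andP[ne_xv rvx] /availableP[xP rx]]].
  move: xvP; rewrite in_setU1 negb_or => /andP[-> xP].
  split; first by rewrite r_sym rx // setU11.
  by apply/availableP; split=> // w Pw; apply: rx; rewrite setU1r.
split=> [|w /setU1P[-> | /rx //]]; first by rewrite !inE negb_or ne_xv.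
by rewrite r_sym.
Qed.

(** Legal moves from [P] are the vertices of [available P], so both recursions agree, by induction
    on [#|~: P|]. *)
Lemma DNT_nim_kayles (e : rel T) : irreflexive r ->
    (forall P, DNT_position e P = independent P) ->
  forall P, independent P -> DNT_nim e P = kayles (available P).
Proof.
move=> r_irr posE P; have [n] := ubnP #|~: P|.
elim: n P => // n IHn P lt_n iP; rewrite DNT_nimE kaylesE.
have IH v : v \in available P ->
    DNT_nim e (v |: P) = kayles (available P :\: closed_nbhd v).
  move=> Av; have /availableP[vP _] := Av.
  have ivP : independent (v |: P) by rewrite independentU1.
  have /card_DNT_options card_vP : v |: P \in DNT_options e P.
    by apply: imset_f; rewrite !inE vP posE.
  by rewrite IHn ?availableU1 //; lia.
apply: eq_mex => u; apply/imageP/imageP => [[_ /imsetP[v + ->] ->] | [v Av ->]].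
  rewrite !inE posE => /andP[vP]; rewrite independentU1 // => Av.
  by exists v; rewrite ?IH.
exists (v |: P); last by rewrite IH.
have /availableP[vP _] := Av.
by apply: imset_f; rewrite !inE vP posE independentU1.
Qed.

End NodeKayles.


(** * Convexity in the wheel *)

(** Distinct nonadjacent vertices are at distance at least 2, so the path through [z] is
    shortest. *)
Lemma convex_mid (T : finType) (e : rel T) (K : {set T}) x y z :
    convex e K -> x \in K -> y \in K -> e x z -> e z y -> ~~ e x y -> x != y ->
  z \in K.
Proof.
move=> /convexP cK Kx Ky exz ezy Nexy ne_xy.
have sp : shortest_path e x y [:: z; y].
  apply/shortest_pathP; split; first by rewrite /walk /= exz ezy eqxx.
  case=> [|w [|//]] /andP[] /=; first by rewrite (negPf ne_xy).
  by rewrite andbT => exw /eqP eq_w; rewrite -eq_w exw in Nexy.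
by apply: cK Kx Ky sp _ _; rewrite inE eqxx.
Qed.

Section Wheel.

Variable m : nat.
Hypothesis m_ge3 : 2 < m.

Local Notation V := (option 'I_m.+1).
Local Notation W := (@wheel m.+2 : rel V).

(** For [n = m + 2] the rim has [m + 1] vertices; natural indices modulo [m + 1] avoid cases for the
    wraparound. *)
Definition rim (j : nat) : V := Some (inord (j %% m.+1)).

(** An option read as a boolean tells that it is not [None]: this is the rim cycle with the center
    isolated. *)
Definition rim_edge : rel V := fun x y => [&& x, y & W x y].

Lemma rim_edge_sym : symmetric rim_edge.
Proof. by move=> x y; rewrite /rim_edge andbCA (@wheel_sym m.+2 x). Qed.

Lemma rim_edge_irr : irreflexive rim_edge.
Proof. have m2_gt2 : 2 < m.+2 by lia.
by move=> x; rewrite /rim_edge (wheel_irr m2_gt2) !andbF. Qed.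

Lemma eq_rim i j : (rim i == rim j) = (i == j %[mod m.+1]).
Proof.
rewrite /rim; apply/eqP/eqP => [[] /(congr1 val) /= | -> //].
by rewrite !inordK ?ltn_pmod.
Qed.

Lemma eq_rim_small i a b : a <= m -> b <= m ->
  (rim (a + i) == rim (b + i)) = (a == b).
Proof. by move=> le_a le_b; rewrite eq_rim eqn_modDr !modn_small. Qed.

Lemma eq_rimS i j : (rim i.+1 == rim j.+1) = (rim i == rim j).
Proof. by rewrite !eq_rim -[i.+1]add1n -[j.+1]add1n eqn_modDl. Qed.

Lemma wheel_rim i j :
  W (rim i) (rim j) = (rim j == rim i.+1) || (rim i == rim j.+1).
Proof.
suff ordS_rim k l : (inord (k %% m.+1) == ordS (inord (l %% m.+1)) :> 'I_m.+1)
    = (rim k == rim l.+1) by rewrite /= !ordS_rim.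
rewrite eq_rim -val_eqE /= !inordK ?ltn_pmod //.
by rewrite -(addn1 (l %% _)) modnDml addn1.
Qed.

Lemma rim_edge_rim i j :
  rim_edge (rim i) (rim j) = (rim j == rim i.+1) || (rim i == rim j.+1).
Proof. exact: wheel_rim. Qed.

Lemma rim_offset i (x : V) : x -> exists2 a, a <= m & x = rim (a + i).
Proof.
(* The residue of [k - i], written so that the subtraction does not truncate. *)
case: x => // k _; exists ((k + (m.+1 - i %% m.+1)) %% m.+1).
  by rewrite -ltnS ltn_pmod.
have -> : Some k = rim k by rewrite /rim modn_small ?ltn_ord // inord_val.
apply/eqP; rewrite eq_rim modnDml -modnDmr.
have lt_i : i %% m.+1 < m.+1 by rewrite ltn_pmod.
have -> : k + (m.+1 - i %% m.+1) + i %% m.+1 = k + m.+1 by lia.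
by rewrite modnDr.
Qed.

Lemma rim_succ (x : V) : x -> exists i, x = rim i.+1.
Proof. by case/(rim_offset 1) => a _ ->; exists a; rewrite addn1. Qed.

Lemma wheel_nbhd i x :
  W (rim i.+1) x -> [|| x == None, x == rim i | x == rim i.+2].
Proof.
case: x => // k; have [//|j ->] := rim_succ (x := Some k).
by rewrite wheel_rim !eq_rimS (eq_sym (rim i)) => /orP[] ->; rewrite ?orbT.
Qed.

Lemma rimSS_neq i : rim i != rim i.+2.
Proof. by rewrite (@eq_rim_small i 0 2) //; lia. Qed.

(** An edge would give 2 = 1 or 0 = 3 modulo [m + 1]; the latter fails because the rim has at least
    four vertices. *)
Lemma wheel_rimSS i : ~~ W (rim i) (rim i.+2).
Proof.
by rewrite wheel_rim (@eq_rim_small i 2 1) ?(@eq_rim_small i 0 3) //; lia.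
Qed.

(** A rim vertex in [P] has both rim neighbours outside [P] and lies midway between them, so the
    hull contains the rim; the center is midway between two rim vertices. *)
Lemma DNT_position_independent (P : {set V}) :
  independent rim_edge P -> DNT_position W P.
Proof.
move=> /independentP iP; rewrite /DNT_position eqEsubset subsetT /=.
set K := hull _ _; have cK : convex W K := convex_hull _ _.
have notP x : x \notin P -> x \in K.
  by move=> Px; apply: (subsetP (sub_hull W (~: P))); rewrite inE.
have Krim i : rim i.+1 \in K.
  have [Pi | /notP //] := boolP (rim i.+1 \in P).
  have K0 : rim i \in K.
    apply: notP; apply/negP => P0; have := iP _ _ P0 Pi.
    by rewrite rim_edge_rim eqxx.
  have K2 : rim i.+2 \in K.
    apply: notP; apply/negP => P2; have := iP _ _ Pi P2.
    by rewrite rim_edge_rim eqxx.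
  apply: convex_mid cK K0 K2 _ _ (wheel_rimSS i) (rimSS_neq i).
    by rewrite wheel_rim eqxx.
  by rewrite wheel_rim eqxx.
apply/subsetP => -[k | ] _; first by have [//|j ->] := rim_succ (x := Some k).
exact: convex_mid cK (Krim 0) (Krim 2) _ _ (wheel_rimSS 1) (rimSS_neq 1).
Qed.

(** Shortest paths have length at most 2, and one of length 2 has both ends on the rim. If its
    midpoint were in the pair, both ends would be the only rim neighbour of that midpoint outside
    the pair, hence equal. *)
Lemma convex_rim_pairC i : convex W (~: [set rim i.+1; rim i.+2]).
Proof.
apply/convexP => x y p; rewrite !inE !negb_or => /andP[x1 x2] /andP[y1 y2].
case/shortest_pathP=> wp min_p.
have ne_xy : p != [::] -> x != y.
  move=> p0; apply: contraNneq p0 => eq_xy; rewrite -size_eq0 -leqn0.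
  by apply: (min_p [::]); rewrite /walk /= eq_xy.
have Nexy : 1 < size p -> ~~ W x y.
  rewrite ltnNge; apply: contra => exy.
  by apply: (min_p [:: y]); rewrite /walk /= exy eqxx.
case: p wp min_p ne_xy Nexy => [|a [|b p]] // /andP[ep /eqP /= eq_y] min_p.
  by rewrite eq_y => _ _ z; rewrite inE => /eqP ->; rewrite !inE negb_or y1 y2.
move=> /(_ isT) ne_xy /(_ isT) Nexy.
have x_rim : x by case: x x1 x2 ep min_p ne_xy Nexy => //; case: y {y1 y2 eq_y}.
have y_rim : y.
  by case: y y1 y2 eq_y min_p ne_xy Nexy => //; case: x {x1 x2 ep} x_rim.
(* The detour through the center has length 2. *)
have p0 : p = [::].
  apply/nilP; have := min_p [:: None; y]; rewrite /walk /= eqxx.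
  by case: x x_rim {x1 x2 ep min_p ne_xy Nexy} => // k _;
     case: y y_rim {y1 y2 eq_y} => // l _ /(_ isT);
     rewrite !ltnS leqn0.
move: ep eq_y; rewrite {}p0 /= andbT => /andP[exa eab] eq_b.
rewrite {}eq_b in eab *.
have ax : W a x by rewrite wheel_sym.
move=> z; rewrite !inE => /orP[] /eqP ->; last by rewrite negb_or y1 y2.
apply/norP; split; apply/negP => /eqP eq_a; rewrite eq_a in ax eab.
  move: (wheel_nbhd ax) (wheel_nbhd eab); rewrite (negPf x2) (negPf y2) !orbF.
  case/orP=> [/eqP x0|/eqP Dx]; first by rewrite x0 in x_rim.
  case/orP=> [/eqP y0|/eqP Dy]; first by rewrite y0 in y_rim.
  by rewrite Dx Dy eqxx in ne_xy.
move: (wheel_nbhd ax) (wheel_nbhd eab); rewrite (negPf x1) (negPf y1) /=.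
case/orP=> [/eqP x0|/eqP Dx]; first by rewrite x0 in x_rim.
case/orP=> [/eqP y0|/eqP Dy]; first by rewrite y0 in y_rim.
by rewrite Dx Dy eqxx in ne_xy.
Qed.

(** If [P] contains two adjacent rim vertices, its complement stays inside the proper convex set of
    [convex_rim_pairC]. *)
Lemma DNT_position_wheel (P : {set V}) :
  DNT_position W P = independent rim_edge P.
Proof.
apply/idP/idP; last exact: DNT_position_independent.
move=> posP; suff NP i : ~~ ((rim i.+1 \in P) && (rim i.+2 \in P)).
  apply/independentP => x y Px Py; apply/negP.
  move=> /and3P[/rim_succ[i Dx] /rim_succ[j Dy]].
  rewrite {}Dx {}Dy wheel_rim in Px Py * => /orP[] /eqP Dij.
    by have := NP i; rewrite -Dij Px Py.
  by have := NP j; rewrite -Dij Px Py.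
apply/negP => /andP[P1 P2]; move: posP; apply/negP.
rewrite /DNT_position eqEsubset subsetT /=; apply/negP.
have sPK : ~: P \subset ~: [set rim i.+1; rim i.+2].
  by rewrite setCS; apply/subsetP => x /set2P[] ->.
move/subsetP/(_ (rim i.+1) (in_setT _)).
by move/(subsetP (hull_min (convex_rim_pairC i) sPK)); rewrite !inE eqxx.
Qed.

(** * The nim-value of the wheel *)

Lemma kayles_hub : kayles rim_edge [set None] = 1.
Proof.
rewrite -[RHS]/(dawson 1) -(@kayles_path _ _ rim_edge_sym (fun=> None)).
- congr kayles; apply/setP => x; rewrite inE.
  by apply/eqP/imsetP => [-> | [i _ ->]] //; exists ord0.
- by move=> [|i] [|j].
- by move=> [|i] [|j].
Qed.

(** By symmetry all options have the same value [d], and the mex of a single value [d] is 1 if [d]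
    is 0 and 0 otherwise. *)
Lemma kayles_rim : kayles rim_edge [set~ None] = (dawson (m - 2) == 0).
Proof.
have opt v : v \in [set~ None] ->
    kayles rim_edge ([set~ None] :\: closed_nbhd rim_edge v) = dawson (m - 2).
  rewrite !inE => Nv; have [|i ->] := @rim_succ v; first by case: v Nv.
  (* Choosing [rim i.+1] removes the offsets 0, 1, 2 from [i]; offsets 3 to [m] form the remaining
     path. *)
  rewrite -(kayles_path rim_edge_sym (f := fun j => rim (j + 3 + i))).
  - congr kayles; apply/setP => x; rewrite !inE.
    apply/andP/imsetP => [[Nx x0] | [j _ ->]].
      have [|a le_a Dx] := @rim_offset i x; first by case: x x0 {Nx}.
      move: Nx; rewrite Dx rim_edge_rim eq_rimS.
      rewrite (@eq_rim_small i a 1) ?(@eq_rim_small i a 2)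
              ?(@eq_rim_small i 0 a) //; try lia.
      move=> Na; have lt_a : a - 3 < m - 2 by lia.
      by exists (Ordinal lt_a) => //=; congr (rim _); lia.
    have lt_j := ltn_ord j; split=> //; rewrite rim_edge_rim eq_rimS.
    by rewrite (@eq_rim_small i _ 1) ?(@eq_rim_small i _ 2)
               ?(@eq_rim_small i 0) //; lia.
  - move=> j l; rewrite !inE => lt_j lt_l /eqP; rewrite eq_rim_small; lia.
  - move=> j l; rewrite !inE => lt_j lt_l.
    by rewrite rim_edge_rim -!addnA -!addSn !eq_rim_small; lia.
rewrite kaylesE; apply/eqP/mexP; split.
  apply/imageP => -[v Rv]; rewrite opt //.
  by case: eqP => [-> | nz /esym].
case: eqP => //= d0 u; rewrite ltnS leqn0 => /eqP ->.
by apply/imageP; exists (rim 0); rewrite ?opt // !inE.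
Qed.

(** The nim-sum with the isolated center, of value 1, negates the bit given by [kayles_rim]. *)
Lemma nim_DNT_wheel : nim_DNT W = (dawson (m - 2) != 0).
Proof.
rewrite /nim_DNT (DNT_nim_kayles rim_edge_sym rim_edge_irr DNT_position_wheel).
  rewrite available0 -(setUCr [set None]) kaylesU.
  - by rewrite kayles_hub kayles_rim; case: eqP.
  - exact: rim_edge_sym.
  - by rewrite -setI_eq0 setICr.
  - by move=> x y /set1P ->.
by apply/independentP => x y; rewrite inE.
Qed.

End Wheel.

Theorem theorem5p24 (n : nat) (hn : 5 <= n) :
  nim_DNT (@wheel n) =
    if [|| n == 18, n == 38 | n %% 34 \in [:: 8; 12; 24; 28; 32]] then 0 else 1.
Proof.
case: n hn => [|[|m]] // hn; rewrite nim_DNT_wheel //.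
rewrite dawson_eq0; last lia.
(* The path length is [m - 2 = n - 4], which shifts the residues and both exceptions by 4. *)
have -> : (m.+2 %% 34 \in [:: 8; 12; 24; 28; 32])
    = ((m - 2) %% 34 \in [:: 4; 8; 20; 24; 28]) by rewrite !inE; lia.
have -> : (m.+2 == 18) = (m - 2 == 14) by lia.
have -> : (m.+2 == 38) = (m - 2 == 34) by lia.
by case: ifP.
Qed.
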